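(* Let $k\in\mathbb{N}$, let $I_0,I_1,\dots,I_k\subseteq\mathbb{R}$ be nonempty open intervals and denote $I:=I_1\times\dots\times I_k$. For all $j\in\{0,1,\dots,k\}$, let $f_j:I_j\to\mathbb{R}$ be strictly increasing, let $\varphi:I\to I_0$ be arbitrary and let $\Phi:I\to\mathbb{R}$ be separately increasing and upper semicontinuous. Let $C_{f_0}\subseteq I_0$ denote the set of points of $I_0$ at which $f_0$ is continuous, and assume that the set $\Gamma:=\{t\in I : \Phi(t)\in C_{f_0}\}$ is a dense subset of $I$. Then the following assertions are equivalent. (a) For all $n\in\mathbb{N}$ and for all $(x_{1,1},\dots,x_{1,k}),\dots,(x_{n,1},\dots,x_{n,k})\in I$, $$A^{[n]}_{f_0}\big(\varphi(x_{1,1},\dots,x_{1,k}),\dots,\varphi(x_{n,1},\dots,x_{n,k})\big)\leq \Phi\Big(A^{[n]}_{f_1}(x_{1,1},\dots,x_{n,1}),\dots,A^{[n]}_{f_k}(x_{1,k},\dots,x_{n,k})\Big).$$ (b) For all $n\in\mathbb{N}$, for all $(x_{1,1},\dots,x_{1,k}),\dots,(x_{n,1},\dots,x_{n,k})\in I$, and for all $\lambda=(\lambda_1,\dots,\lambda_n)\in\Lambda_n$, $$\widetilde{A}^{[n]}_{f_0}\big(\varphi(x_{1,1},\dots,x_{1,k}),\dots,\varphi(x_{n,1},\dots,x_{n,k});\lambda\big)\leq \Phi\Big(\widetilde{A}^{[n]}_{f_1}(x_{1,1},\dots,x_{n,1};\lambda),\dots,\widetilde{A}^{[n]}_{f_k}(x_{1,k},\dots,x_{n,k};\lambda)\Big).$$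 (c) For all $(x_{1,1},\dots,x_{1,k}),\dots,(x_{k+1,1},\dots,x_{k+1,k})\in I$ and for all $\lambda=(\lambda_1,\dots,\lambda_{k+1})\in\Lambda_{k+1}$, $$\widetilde{A}^{[k+1]}_{f_0}\big(\varphi(x_{1,1},\dots,x_{1,k}),\dots,\varphi(x_{k+1,1},\dots,x_{k+1,k});\lambda\big)\leq \Phi\Big(\widetilde{A}^{[k+1]}_{f_1}(x_{1,1},\dots,x_{k+1,1};\lambda),\dots,\widetilde{A}^{[k+1]}_{f_k}(x_{1,k},\dots,x_{k+1,k};\lambda)\Big).$$ (d) For all $j\in\{1,\dots,k\}$, there exists a nonnegative function $a_j:\Gamma\to\mathbb{R}$ such that, for all $(x_1,\dots,x_k)\in I$ and $(t_1,\dots,t_k)\in\Gamma$, $$f_0\big(\varphi(x_1,\dots,x_k)\big)-f_0\big(\Phi(t_1,\dots,t_k)\big)\leq \sum_{j=1}^k a_j(t_1,\dots,t_k)\big(f_j(x_j)-f_j(t_j)\big).$$ (e) There exists a separately increasing concave function $\Psi:\operatorname{conv}(f_1(I_1))\times\dots\times\operatorname{conv}(f_k(I_k))\to\mathbb{R}$ such that, for all $(x_1,\dots,x_k)\in I$, $$f_0\big(\varphi(x_1,\dots,x_k)\big)\leq\Psi\big(f_1(x_1),\dots,f_k(x_k)\big)$$ and, for all $(t_1,\dots,t_k)\in\Gamma$, $$f_0\big(\Phi(t_1,\dots,t_k)\big)\geq\Psi\big(f_1(t_1),\dots,f_k(t_k)\big).$$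
   Context: Conventions: $\mathbb{N}=\{1,2,\dots\}$; ''increasing'' means nondecreasing (as opposed to ''strictly increasing''); a function of several variables is separately increasing if it is increasing in each variable when the other variables are fixed. $\operatorname{conv}(S)$ is the convex hull of $S\subseteq\mathbb{R}$. Weights: $\Lambda_n:=[0,\infty)^n\setminus\{(0,\dots,0)\}$. Generalized inverse: if $J\subseteq\mathbb{R}$ is a nonempty open interval and $f:J\to\mathbb{R}$ is strictly increasing (not necessarily continuous), then there is a unique increasing function $f^{(-1)}:\operatorname{conv}(f(J))\to J$ with $f^{(-1)}(f(x))=x$ for all $x\in J$; it is called the generalized inverse of $f$ (it is continuous and satisfies $f(f^{(-1)}(y))=y$ for $y\in f(J)$). Generalized quasi-arithmetic means: for such $f$ and $n\in\mathbb{N}$, $$A^{[n]}_{f}(x_1,\dots,x_n):=f^{(-1)}\Big(\frac{f(x_1)+\dots+f(x_n)}{n}\Big)\quad (x\in J^n),$$ $$\widetilde{A}^{[n]}_{f}(x_1,\dots,x_n;\lambda_1,\dots,\lambda_n):=f^{(-1)}\Big(\frac{\lambda_1f(x_1)+\dots+\lambda_nf(x_n)}{\lambda_1+\dots+\lambda_n}\Big)\quad (x\in J^n,\ \lambda\in\Lambda_n).$$ *)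

(* Defs.v *)
From HB Require Import structures.
From mathcomp Require Import all_boot all_order all_algebra.
From mathcomp Require Import all_classical all_reals all_analysis.

Set Implicit Arguments.
Unset Strict Implicit.
Unset Printing Implicit Defensive.

Import Order.TTheory GRing.Theory Num.Theory.
Import numFieldNormedType.Exports.

Local Open Scope classical_set_scope.
Local Open Scope ring_scope.

(* Functions on a subset of R or R^k are total functions here; every notion
   below only looks at their values on that subset. *)

Definition open_interval (R : realType) (J : set R) : Prop :=
  [/\ J !=set0, open J & is_interval J].

Definition strictly_increasing_on (R : realType) (J : set R) (f : R -> R) :
  Prop := {in J &, {homo f : x y / x < y}}.

Definition conv_hull (R : realType) (S : set R) : set R :=
  smallest (@convex_set R R^o) S.

Definition is_generalized_inverse (R : realType) (J : set R) (f g : R -> R) :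
    Prop :=
  let D := conv_hull (f @` J) in
  [/\ {in D &, {homo g : x y / x <= y}}, set_fun D J g &
      forall x, J x -> g (f x) = x].

(* The default value [fun=> 0] is not used when [J] is an interval and [f]
   is strictly increasing on it ([generalized_inverseP]), and the choice is
   unique on [conv_hull (f @` J)] ([generalized_inverse_unique]). *)
Definition generalized_inverse (R : realType) (J : set R) (f : R -> R) :
    R -> R :=
  xget (fun=> 0) [set g | is_generalized_inverse J f g].

Definition qamean (R : realType) (J : set R) (f : R -> R) (n : nat)
    (x : 'I_n -> R) : R :=
  generalized_inverse J f ((\sum_(i < n) f (x i)) / n%:R).

Definition weights (R : realType) (n : nat) : set 'rV[R]_n :=
  [set l | (forall i, 0 <= l 0 i) /\ l != 0].

Definition wqamean (R : realType) (J : set R) (f : R -> R) (n : nat)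
    (x : 'I_n -> R) (l : 'rV[R]_n) : R :=
  generalized_inverse J f
    ((\sum_(i < n) l 0 i * f (x i)) / \sum_(i < n) l 0 i).

Definition box (R : realType) (k : nat) (I : 'I_k -> set R) : set 'rV[R]_k :=
  [set x | forall j, I j (x 0 j)].

Definition separately_increasing_on (R : realType) (k : nat)
    (D : set 'rV[R]_k) (F : 'rV[R]_k -> R) : Prop :=
  forall (j : 'I_k) (x y : 'rV[R]_k), D x -> D y ->
    (forall i, i != j -> x 0 i = y 0 i) -> x 0 j <= y 0 j -> F x <= F y.

Definition upper_semicontinuous_on (R : realType) (k : nat)
    (D : set 'rV[R]_k) (F : 'rV[R]_k -> R) : Prop :=
  forall x, D x -> forall a, F x < a ->
    \forall y \near within D (nbhs x), F y < a.

Definition concave_on (R : realType) (k : nat)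
    (D : set 'rV[R]_k) (F : 'rV[R]_k -> R) : Prop :=
  @convex_function R 'rV[R]_k D (fun x => - F x).

Definition continuity_points (R : realType) (J : set R) (f : R -> R) : set R :=
  [set t | J t /\ f x @[x --> within J (nbhs t)] --> f t].

Lemma conv_hullE (R : realType) (S : set R) :
  conv_hull S = [set y | exists a b, [/\ S a, S b & a <= y <= b]].
Proof.
apply/seteqP; split => y.
- apply: smallest_sub => [u v t|x Sx]; last by exists x, x; split; rewrite ?lexx.
  move=> /set_mem[a [b [Sa Sb /andP[au ub]]]].
  move=> /set_mem[c [d [Sc Sd /andP[cv vd]]]]; apply/mem_set.
  have [lo [Slo lou lov]] : exists e, [/\ S e, e <= u & e <= v].
    have [ac|ca] := leP a c; first by exists a; split=> //; exact: le_trans cv.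
    by exists c; split=> //; exact: le_trans (ltW ca) au.
  have [hi [Shi uhi vhi]] : exists e, [/\ S e, u <= e & v <= e].
    have [bd|db] := leP b d; first by exists d; split=> //; exact: le_trans bd.
    by exists b; split=> //; exact: le_trans vd (ltW db).
  exists lo, hi; split=> //.
  have t0 : 0 <= t%:inum by [].
  have t1 : 0 <= 1 - t%:inum by rewrite subr_ge0.
  have E (z : R) : z = t%:inum * z + (1 - t%:inum) * z.
    by rewrite -mulrDl addrC subrK mul1r.
  by apply/andP; split; [rewrite [leLHS]E|rewrite [leRHS]E];
    apply: lerD; apply: ler_wpM2l.
- move=> [a [b [Sa Sb ayb]]] M [cM SM].
  have [ab|ba0] := ltP a b; last first.
    suff -> : y = a by exact: SM.
    by case/andP: ayb => ay yb; apply/le_anti; rewrite ay (le_trans yb).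
  have ba : 0 < b - a by rewrite subr_gt0.
  case/andP: ayb => ay yb.
  have h0 : 0 <= (b - y) / (b - a) by rewrite divr_ge0 ?subr_ge0// ltW.
  have h1 : (b - y) / (b - a) <= 1.
    by rewrite ler_pdivrMr// mul1r lerD2l lerN2.
  have := cM a b (Itv01 h0 h1).
  rewrite !inE => /(_ (SM _ Sa) (SM _ Sb)).
  suff -> : conv (Itv01 h0 h1) (a : convex_lmodType R^o) b = y by [].
  rewrite -[LHS]/((b - y) / (b - a) * a + (1 - (b - y) / (b - a)) * b).
  set t := _ / _; have tE : t * (b - a) = b - y by rewrite mulfVK ?gt_eqF.
  by rewrite mulrBl mul1r addrCA -mulrBr -opprB mulrN tE subKr.
Qed.

Lemma generalized_inverseP (R : realType) (J : set R) (f : R -> R) :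
  is_interval J -> strictly_increasing_on J f ->
  is_generalized_inverse J f (generalized_inverse J f).
Proof.
move=> itvJ fJ; apply: (xgetPex (fun=> 0)).
have leJ x y : J x -> J y -> (f x <= f y) = (x <= y).
  move=> Jx Jy; apply/idP/idP; first by apply: contraTT; rewrite -!ltNge;
    apply: fJ; rewrite inE.
  by rewrite le_eqVlt => /orP[/eqP->//|/fJ /ltW]; apply; rewrite inE.
pose L y := [set x | J x /\ f x <= y].
have Lsup y : conv_hull (f @` J) y -> has_sup (L y) /\ J (sup (L y)).
  rewrite conv_hullE => -[_ [_ [[a Ja <-] [b Jb <-] /andP[ay yb]]]].
  have ubb : ubound (L y) b.
    by move=> x [Jx fxy]; rewrite -leJ// (le_trans fxy).
  have hs : has_sup (L y) by split; [exists a | exists b].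
  split=> //; apply: (itvJ a b) => //; apply/andP; split.
    by apply: ub_le_sup; [exists b | split].
  by apply: ge_sup => //; exists a.
exists (fun y => sup (L y)); split.
- move=> y z; rewrite !inE => /Lsup[[Ly0 _] _] /Lsup[[_ ubz] _] yz.
  apply: ge_sup => // x [Jx fx]; apply: ub_le_sup => //.
  by split => //; exact: le_trans yz.
- by move=> y /Lsup[].
- move=> x Jx; apply/le_anti/andP; split.
    by apply: ge_sup => [|z [Jz]]; [exists x | rewrite leJ].
  by apply: ub_le_sup => //; exists x => z [Jz]; rewrite leJ.
Qed.

Lemma generalized_inverse_unique (R : realType) (J : set R) (f g h : R -> R) :
  is_interval J -> is_generalized_inverse J f g ->
  is_generalized_inverse J f h -> {in conv_hull (f @` J), g =1 h}.
Proof.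
move=> itvJ.
suff le g1 g2 : is_generalized_inverse J f g1 ->
    is_generalized_inverse J f g2 ->
    {in conv_hull (f @` J), forall y, g1 y <= g2 y}.
  by move=> gP hP y yD; apply/le_anti; rewrite !le.
move=> [i1 r1 c1] [i2 r2 c2] y yD; rewrite leNgt; apply/negP => lt21.
have [J1 J2] : J (g1 y) /\ J (g2 y).
  by split; [apply: r1|apply: r2]; exact: set_mem yD.
have [m1 m2] := midf_lt lt21; move: (_ / _) m1 m2 => m m1 m2.
have Jm : J m by apply: (itvJ _ _ J2 J1); rewrite !ltW.
have fmD : f m \in conv_hull (f @` J).
  by apply: mem_set; apply: sub_gen_smallest; exists m.
have [ym|my] := leP y (f m).
  by have := i1 _ _ yD fmD ym; rewrite c1// leNgt m2.
by have := i2 _ _ fmD yD (ltW my); rewrite c2// leNgt m1.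
Qed.

(* Main.v *)
Require Import Defs.
From HB Require Import structures.
From mathcomp Require Import all_boot all_order all_algebra.
From mathcomp Require Import all_classical all_reals all_analysis.
From mathcomp Require Import ring lra.

Set Implicit Arguments.
Unset Strict Implicit.
Unset Printing Implicit Defensive.

Import Order.TTheory GRing.Theory Num.Theory.
Import numFieldNormedType.Exports.
Local Open Scope classical_set_scope.
Local Open Scope ring_scope.

(** Write gap_j(t, x) = f_j(x_j) - f_j(t_j) and gap_0(t, x) = f_0(phi x) -
    f_0(Phi t).  For a fixed family of points x_i with weights l_i, the
    comparison inequality between the means is equivalent to the following
    condition, required at every t in Gamma:

      if sum_i l_i gap_j(t, x_i) <= 0 for all j, then
      sum_i l_i gap_0(t, x_i) <= 0                                (G)

    ([mean_inequality_iff_gaps]).  Indeed, the premise of (G) says that the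
    mean of the f_j(x_ij) is at most f_j(t_j), which bounds the j-th
    quasi-arithmetic mean by t_j, and monotonicity of Phi passes to Phi t.
    Since f_0 is continuous at Phi t, a bound Phi t on the quasi-arithmetic
    mean for f_0 gives back the bound f_0(Phi t) on the arithmetic mean of the
    f_0(phi x_i).  Conversely, by density of Gamma the point of means can be
    approached by points t of Gamma that are strictly larger in every
    coordinate; such t satisfy the premise of (G), and upper semicontinuity
    of Phi carries the conclusion over to the limit.

    Thus (a), (b) and (c) assert (G) at every t in Gamma for unit weights, for
    arbitrary weights, and for k + 1 points, and these assertions are
    equivalent for elementary reasons.

    - Unit weights give natural weights by repetition of points.  They give
      real weights by rounding: the rounding errors stay bounded when the
      weights are scaled up, and they are absorbed by finitely many copies of
      one point all of whose gaps are negative, which exists because the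
      intervals are open ([real_weights_of_unit_weights]).
    - k + 1 points give any number of points by an argument of Caratheodory
      type: as long as more than k + 1 weights are nonzero, they can be moved
      along an affine dependence between the gap vectors, in the direction
      that does not decrease the sum for gap_0, until one of them vanishes
      ([caratheodory_points]).

    By (G), the convex cone generated by the pairs (gap(t, x), gap_0(t, x)) is
    disjoint from the set u <= 0, v > 0.  A Farkas lemma
    ([farkas_nonneg_multipliers]) turns this into the multipliers a_j(t) >= 0
    of (d); the point with negative gaps plays the part of a Slater point and
    excludes a vertical hyperplane.

    Given the multipliers, the infimum over t in Gamma of the affine functions
    f_0(Phi t) + sum_j a_j(t) (y_j - f_j(t_j)) is the function Psi of (e).
    Given Psi, Jensen's inequality for equal weights and monotonicity of Psi
    yield (G) for unit weights, hence (a). *)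

(** * Convex cones and nonnegative multipliers *)

(** A Hahn-Banach extension, one direction at a time.  The cone [C] is kept
    as a set of pairs rather than replaced by the function
    [u => sup {v | C u v}].  A line through a pair [(e, alpha)] can be added to
    [C] without breaking [C 0 v -> v <= 0] as soon as [alpha] lies between all
    [w] with [C e w] and all [- w] with [C (- e) w]; the supremum of the former
    is such a number.  Once a line has been added in each direction, the cone
    lies below a linear function. *)
Lemma convex_cone_linear_majorant (R : realType) (V : lmodType R) (n : nat)
    (e : 'I_n -> V) (C : V -> R -> Prop) :
  (forall u u' v v', C u v -> C u' v' -> C (u + u') (v + v')) ->
  (forall c u v, 0 < c -> C u v -> C (c *: u) (c * v)) ->
  (forall v, C 0 v -> v <= 0) -> (forall u, exists v, C u v) ->
  exists a : 'I_n -> R, forall (s : 'I_n -> R) v,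
    C (\sum_i s i *: e i) v -> v <= \sum_i s i * a i.
Proof.
elim: n => [|n IH] in e C * => CD CZ C0 Cex.
  by exists (fun=> 0) => s v; rewrite !big_ord0 => /C0.
have [w' Cw'] := Cex (- e ord0).
have [w0 Cw0] := Cex (e ord0).
have Cub w w1 : C (e ord0) w -> C (- e ord0) w1 -> w <= - w1.
  by move=> Cw Cw1; rewrite -subr_le0 opprK C0// -(subrr (e ord0)); exact: CD.
have Csup : has_sup [set w | C (e ord0) w].
  by split; [exists w0 | exists (- w') => w /Cub; apply].
pose alpha := sup [set w | C (e ord0) w].
pose C' u v := exists s, C (u + s *: e ord0) (v + s * alpha).
have CC' u v : C u v -> C' u v.
  by move=> Cuv; exists 0; rewrite scale0r mul0r !addr0.
have [||||a aP] := IH (fun i => e (lift ord0 i)) C'.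
- move=> u u' v v' [s Cs] [s' Cs']; exists (s + s').
  by rewrite scalerDl mulrDl addrACA (addrACA v); exact: CD.
- move=> c u v c0 [s /(CZ _ _ _ c0)]; rewrite scalerDr mulrDr scalerA mulrA.
  by exists (c * s).
- move=> v [s]; rewrite add0r => Cs.
  have [s0|s0|s0] := ltgtP s 0; last 1 first.
  + by move: Cs; rewrite s0 scale0r mul0r addr0 => /C0.
  (* Scaling to s = -1: then alpha, being a supremum, is at most alpha + v/s. *)
  + have t0 : 0 < (- s)^-1 by rewrite invr_gt0 oppr_gt0.
    have := CZ _ _ _ t0 Cs.
    rewrite scalerA invrN mulNr mulVf ?lt_eqF// scaleN1r.
    move=> Cm; have : alpha <= - (- s^-1 * (v + s * alpha)).
      by apply: ge_sup; [exists w0 | move=> w /Cub; apply].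
    rewrite mulNr opprK mulrDr mulKf ?lt_eqF// -subr_ge0 addrK.
    by rewrite nmulr_rge0// invr_lt0.
  + have t0 : 0 < s^-1 by rewrite invr_gt0.
    have := CZ _ _ _ t0 Cs; rewrite scalerA mulVf ?gt_eqF// scale1r => Cm.
    have : s^-1 * (v + s * alpha) <= alpha.
      by apply: ub_le_sup => //; case: Csup.
    by rewrite mulrDr mulKf ?gt_eqF// gerDr pmulr_rle0.
- by move=> u; have [v Cuv] := Cex u; exists v; exact: CC'.
(* The induction covers the directions other than ord0; alpha is the slope
   along ord0. *)
exists (fun i => if unlift ord0 i is Some j then a j else alpha) => s v Cv.
rewrite big_ord_recl unlift_none.
under eq_bigr do rewrite liftK.
rewrite -lerBlDl; apply: (aP (fun i => s (lift ord0 i))); exists (s ord0).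
by rewrite subrK addrC; rewrite big_ord_recl in Cv.
Qed.

(** The pairs [(w, z)] dominated by a nonnegative combination of the pairs
    [(u x, v x)], in the sense that the combination is at most [w] in the first
    component and at least [z] in the second, form a convex cone to which
    [convex_cone_linear_majorant] applies.  The point [x0] guarantees that
    every [w] occurs: a large multiple of the negative vector [u x0] lies below
    it.  Since [w] may be increased freely, the unit vectors occur with
    [z = 0], so the coefficients of the majorant are nonnegative. *)
Lemma farkas_nonneg_multipliers (R : realType) (k : nat) (T : Type) (B : set T)
    (u : T -> 'I_k -> R) (v : T -> R) (x0 : T) :
  B x0 -> (forall j, u x0 j < 0) ->
  (forall (J : finType) (x : J -> T) (l : J -> R),
    (forall i, B (x i)) -> (forall i, 0 <= l i) ->
    (forall j, \sum_i l i * u (x i) j <= 0) -> \sum_i l i * v (x i) <= 0) ->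
  exists a : 'I_k -> R, (forall j, 0 <= a j) /\
    forall x, B x -> v x <= \sum_j a j * u x j.
Proof.
move=> Bx0 ux0 H.
pose C (w : 'rV[R]_k) (z : R) :=
  exists (J : finType) (x : J -> T) (l : J -> R),
    [/\ forall i, B (x i), forall i, 0 <= l i,
        forall j, \sum_i l i * u (x i) j <= w 0 j & z <= \sum_i l i * v (x i)].
have [||||a aP] :=
    @convex_cone_linear_majorant R _ k (fun j => delta_mx 0 j) C.
- move=> w w' z z' [J [x [l [Bx l0 lw lz]]]] [J' [x' [l' [Bx' l0' lw' lz']]]].
  exists (J + J')%type.
  exists (fun i => match i with inl i => x i | inr i => x' i end).
  exists (fun i => match i with inl i => l i | inr i => l' i end).
  split; [by case|by case|move=> j|].
  + by rewrite big_sumType mxE; exact: lerD.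
  + by rewrite big_sumType; exact: lerD.
- move=> c w z c0 [J [x [l [Bx l0 lw lz]]]].
  exists J, x, (fun i => c * l i); split => //.
  + by move=> i; rewrite mulr_ge0// ltW.
  + move=> j; under eq_bigr do rewrite -mulrA.
    by rewrite -mulr_sumr mxE ler_pM2l.
  + under eq_bigr do rewrite -mulrA.
    by rewrite -mulr_sumr ler_pM2l.
- move=> z [J [x [l [Bx l0 lw /le_trans]]]]; apply; apply: H => // j.
  by rewrite (le_trans (lw j))// mxE.
- move=> w; pose c := \sum_j `|w 0 j| / - u x0 j.
  have cj j : 0 <= `|w 0 j| / - u x0 j by rewrite divr_ge0// oppr_ge0 ltW.
  exists (c * v x0), 'I_1, (fun=> x0), (fun=> c).
  split=> // [_|j|]; rewrite ?big_ord1//; first exact: sumr_ge0.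
  have cle : `|w 0 j| <= c * - u x0 j.
    by rewrite -ler_pdivrMr ?oppr_gt0// /c (bigD1 j)//= lerDl sumr_ge0.
  have := ler_norm (- w 0 j); rewrite normrN; lra.
have rowE (s : 'I_k -> R) j : (\sum_i s i *: delta_mx 0 i : 'rV_k) 0 j = s j.
  rewrite summxE (bigD1 j)//= big1 => [|i /negPf ij].
    by rewrite addr0 !mxE !eqxx mulr1.
  by rewrite !mxE eqxx/= eq_sym ij mulr0.
exists a; split=> [j|x Bx].
  have <- : \sum_i (i == j)%:R * a i = a j.
    rewrite (bigD1 j)//= eqxx mul1r big1 ?addr0// => i /negPf->.
    by rewrite mul0r.
  apply: aP; exists 'I_0, (fun=> x0), (fun=> 0).
  by split=> [||j'|]; rewrite ?big_ord0// rowE ler0n.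
under eq_bigr do rewrite mulrC.
apply: (aP (fun j => u x j)).
exists 'I_1, (fun=> x), (fun=> 1); split=> // [j|].
  by rewrite rowE big_ord1 mul1r.
by rewrite big_ord1 mul1r.
Qed.

(** * From unit weights to real weights *)

Lemma nat_weights_of_unit_weights (R : realType) (k : nat) (T : Type)
    (B : set T) (u : T -> 'I_k -> R) (v : T -> R) :
  (forall (J : finType) (x : J -> T), (forall i, B (x i)) ->
    (forall j, \sum_i u (x i) j <= 0) -> \sum_i v (x i) <= 0) ->
  forall (J : finType) (x : J -> T) (p : J -> nat), (forall i, B (x i)) ->
    (forall j, \sum_i (p i)%:R * u (x i) j <= 0) ->
    \sum_i (p i)%:R * v (x i) <= 0.
Proof.
move=> H J x p Bx up.
have E (F : T -> R) :
    \sum_i (p i)%:R * F (x i) = \sum_(c : {i : J & 'I_(p i)}) F (x (tag c)).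
  transitivity (\sum_i \sum_(j < p i) F (x i)).
    by apply: eq_bigr => i _; rewrite sumr_const card_ord mulr_natl.
  by rewrite sig_big_dep.
rewrite E; apply: (H _ (fun c => x (tag c))) => // j.
by rewrite -(E (u^~ j)).
Qed.

(** If the conclusion failed, replace [l i] by the integer part of [N * l i]
    and add [q] copies of [x0].  Rounding changes each sum by at most a
    constant that does not depend on [N].  First choose [q] so large that
    [q * u x0 j] compensates this constant in every premise, then [N] so large
    that the sum of the [v (x i)], which grows linearly in [N], outweighs both
    the constant and [q * v x0]. *)
Lemma real_weights_of_unit_weights (R : realType) (k : nat) (T : Type)
    (B : set T) (u : T -> 'I_k -> R) (v : T -> R) (x0 : T) :
  B x0 -> (forall j, u x0 j < 0) ->
  (forall (J : finType) (x : J -> T), (forall i, B (x i)) ->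
    (forall j, \sum_i u (x i) j <= 0) -> \sum_i v (x i) <= 0) ->
  forall (J : finType) (x : J -> T) (l : J -> R), (forall i, B (x i)) ->
    (forall i, 0 <= l i) -> (forall j, \sum_i l i * u (x i) j <= 0) ->
    \sum_i l i * v (x i) <= 0.
Proof.
move=> Bx0 ux0 H J x l Bx l0 lu; rewrite leNgt; apply/negP => lv.
pose bound (F : T -> R) : R := \sum_i `|F (x i)|.
have round (F : T -> R) (N : nat) :
    `|\sum_i (Num.truncn (N%:R * l i))%:R * F (x i)
      - N%:R * \sum_i l i * F (x i)| <= bound F.
  rewrite mulr_sumr -sumrB (le_trans (ler_norm_sum _ _ _))//.
  apply: ler_sum => i _; rewrite mulrA -mulrBl normrM ler_piMl// distrC.
  have Nl : 0 <= N%:R * l i by rewrite mulr_ge0// ler0n.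
  have /andP[t1 t2] := truncn_itv Nl.
  by rewrite ger0_norm ?subr_ge0// lerBlDl natr1 ltW.
pose q := (Num.truncn (\sum_j bound (u^~ j) / - u x0 j)).+1.
have qP j : bound (u^~ j) + q%:R * u x0 j <= 0.
  have bj j' : 0 <= bound (u^~ j') / - u x0 j'.
    by rewrite divr_ge0 ?sumr_ge0// oppr_ge0 ltW.
  have : bound (u^~ j) / - u x0 j <= q%:R.
    apply: le_trans (ltW (truncnS_gt _)).
    by rewrite (bigD1 j)//= lerDl sumr_ge0.
  rewrite ler_pdivrMr ?oppr_gt0// mulrN; lra.
pose N := (Num.truncn ((bound v - q%:R * v x0) / \sum_i l i * v (x i))).+1.
have NP : bound v - q%:R * v x0 < N%:R * \sum_i l i * v (x i).
  rewrite -ltr_pdivrMr// (lt_le_trans (truncnS_gt _))//.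
suff : \sum_(i : 'I_1 + J) (match i with
         | inl _ => q | inr i => Num.truncn (N%:R * l i) end)%:R *
       v (match i with inl _ => x0 | inr i => x i end) <= 0.
  rewrite big_sumType/= big_ord1 => vle.
  have := round v N; rewrite ler_norml => /andP[+ _]; lra.
apply: (@nat_weights_of_unit_weights _ _ _ B u) => //; first by case.
move=> j; rewrite big_sumType/= big_ord1.
have := round (u^~ j) N; rewrite ler_norml => /andP[_].
have := qP j; have := lu j; have : 0 <= N%:R :> R by rewrite ler0n.
move=> N0 /(mulr_ge0_le0 N0); lra.
Qed.

(** * Reduction to k + 1 weights *)

Lemma affine_dependence (R : fieldType) (k : nat) (J : finType)
    (u : J -> 'I_k -> R) (A : {pred J}) : (k.+1 < #|A|)%N ->
  exists mu : J -> R, [/\ exists i, mu i != 0, forall i, i \notin A -> mu i = 0,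
    \sum_i mu i = 0 & forall j, \sum_i mu i * u i j = 0].
Proof.
move=> kA.
pose M := \matrix_(c < #|A|, j < k.+1)
  oapp (u (enum_val c)) 1 (unlift ord0 j).
have : kermx M != 0.
  rewrite kermx_eq0 /row_free; apply: contraTneq kA => <-.
  by rewrite -leqNgt rank_leq_col.
case/rowV0Pn => w /sub_kermxP wM w0.
have [c0 wc0] : exists c, w 0 c != 0 by exact/rV0Pn.
pose mu i := if i \in A then w 0 (enum_rank_in (enum_valP c0) i) else 0.
have muE c : mu (enum_val c) = w 0 c by rewrite /mu enum_valP enum_valK_in.
have sumE (F : J -> R) : \sum_i mu i * F i = \sum_c w 0 c * F (enum_val c).
  under [RHS]eq_bigr do rewrite -muE.
  rewrite -(big_enum_val (fun i => mu i * F i)) [LHS](bigID (mem A))/=.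
  by rewrite [X in _ + X]big1 ?addr0// => i /negPf iA; rewrite /mu iA mul0r.
exists mu; split.
- by exists (enum_val c0); rewrite muE.
- by move=> i /negPf iA; rewrite /mu iA.
- under eq_bigr do rewrite -[mu _]mulr1.
  rewrite sumE; have := congr1 (fun B : 'rV_k.+1 => B 0 ord0) wM.
  rewrite !mxE => wMj; rewrite -[RHS]wMj.
  by apply: eq_bigr => c _; rewrite mxE unlift_none.
- move=> j; rewrite sumE.
  have := congr1 (fun B : 'rV_k.+1 => B 0 (lift ord0 j)) wM.
  rewrite !mxE => wMj; rewrite -[RHS]wMj.
  by apply: eq_bigr => c _; rewrite mxE liftK.
Qed.

(** Unlike in the usual Caratheodory theorem, the vectors are not preserved in
    all coordinates: the combination of the [u i] is kept, and that of the
    [v i] may increase.  This saves one point, namely [k + 1] instead of the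
    [k + 2] that vectors in dimension [k + 1] would require. *)
Lemma caratheodory_small_support (R : realFieldType) (k : nat) (J : finType)
    (u : J -> 'I_k -> R) (v : J -> R) (l : J -> R) : (forall i, 0 <= l i) ->
  exists l' : J -> R,
    [/\ forall i, 0 <= l' i, \sum_i l' i = \sum_i l i,
        forall j, \sum_i l' i * u i j = \sum_i l i * u i j,
        \sum_i l i * v i <= \sum_i l' i * v i
      & (#|[pred i | l' i != 0%R]| <= k.+1)%N].
Proof.
move: {2}#|_| (leqnn #|[pred i | l i != 0]|) => n.
elim: n => [|n IH] in l * => suppl l0.
  by exists l; split => //; exact: leq_trans suppl _.
set A := [pred i | l i != 0] in suppl.
have [Ak|kA] := leqP #|A| k.+1; first by exists l.
have [mu [mun0 muA mu1 muu muv]] : exists mu : J -> R,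
    [/\ exists i, mu i != 0, forall i, i \notin A -> mu i = 0,
      \sum_i mu i = 0, forall j, \sum_i mu i * u i j = 0 &
      0 <= \sum_i mu i * v i].
  have [mu [[i mui] muA mu1 muu]] := affine_dependence u kA.
  have [muv|muv] := leP 0 (\sum_i mu i * v i).
    by exists mu; split => //; exists i.
  exists (fun i => - mu i); split.
  - by exists i; rewrite oppr_eq0.
  - by move=> i' /muA ->; rewrite oppr0.
  - by rewrite sumrN mu1 oppr0.
  - by move=> j; under eq_bigr do rewrite mulNr; rewrite sumrN muu oppr0.
  - by under eq_bigr do rewrite mulNr; rewrite sumrN oppr_ge0 ltW.
(* mu is nonzero with sum zero, so it has a negative entry; moving along mu
   makes some weight vanish after the finite time s, and none becomes
   negative before. *)
have [i1 mui1] : exists i, mu i < 0.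
  apply/existsP; apply: contraT; rewrite negb_exists => /forallP mu_ge0.
  have [i /negP[]] := mun0; apply/eqP.
  by apply: (psumr_eq0P _ mu1) => // j _; rewrite leNgt.
case: (@real_arg_minP _ _ i1 (fun i => mu i < 0) (fun i => l i / - mu i)
    mui1 (fun i _ => num_real _)) => i0 mui0 i0min.
pose s := l i0 / - mu i0.
have s0 : 0 <= s by rewrite divr_ge0// oppr_ge0 ltW.
pose l' i := l i + s * mu i.
have l'sum (F : J -> R) :
    \sum_i l' i * F i = \sum_i l i * F i + s * \sum_i mu i * F i.
  rewrite mulr_sumr -big_split; apply: eq_bigr => i _ /=.
  by rewrite mulrDl mulrA.
have l'0 i : 0 <= l' i.
  have [mui|mui] := leP 0 (mu i); first by rewrite addr_ge0// mulr_ge0.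
  have := i0min _ mui; rewrite ler_pdivlMr ?oppr_gt0// mulrN -/s /l'; lra.
have l'i0 : l' i0 = 0.
  by rewrite /l' /s invrN mulrN mulNr mulfVK ?lt_eqF// subrr.
have [|//|l2 [l20 l21 l2u l2v l2k]] := IH l'.
  rewrite -ltnS; apply: leq_trans suppl; apply: proper_card.
  apply/properP; split.
    apply/fintype.subsetP => i; rewrite !inE; apply: contraNneq => li.
    by rewrite /l' li muA ?mulr0 ?addr0// inE li eqxx.
  exists i0; rewrite !inE ?l'i0 ?eqxx//; apply: contraTneq mui0 => li0.
  by rewrite muA ?ltxx// inE li0 eqxx.
exists l2; split => //.
- by rewrite l21 big_split/= -mulr_sumr mu1 mulr0 addr0.
- by move=> j; rewrite l2u l'sum muu mulr0 addr0.
- by apply: le_trans l2v; rewrite l'sum lerDl mulr_ge0.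
Qed.

(** The support is listed in [k + 1] slots; the slots left over repeat an
    arbitrary point with weight zero. *)
Lemma caratheodory_points (R : realType) (k : nat) (J : finType)
    (u : J -> 'I_k -> R) (v : J -> R) (l : J -> R) :
  (forall i, 0 <= l i) -> 0 < \sum_i l i ->
  exists (y : 'I_k.+1 -> J) (m : 'rV[R]_k.+1),
    [/\ weights m,
        forall j, \sum_c m 0 c * u (y c) j = \sum_i l i * u i j &
        \sum_i l i * v i <= \sum_c m 0 c * v (y c)].
Proof.
move=> l0 lpos.
have [l' [l'0 l'1 l'u l'v l'k]] :=
  caratheodory_small_support u v l0.
set A := [pred i | l' i != 0%R] in l'k.
have [i0 _] : exists i, l' i != 0.
  apply/existsP; apply: contraT; rewrite negb_exists => /forallP l'_eq0.
  move: lpos; rewrite -l'1 big1 ?ltxx// => i _.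
  by have := l'_eq0 i; rewrite negbK => /eqP.
pose y (c : 'I_k.+1) := nth i0 (enum A) c.
pose m : 'rV[R]_k.+1 := \row_c if (c < #|A|)%N then l' (y c) else 0.
have sumE (F : J -> R) : \sum_c m 0 c * F (y c) = \sum_i l' i * F i.
  transitivity (\sum_(c < k.+1 | (c < #|A|)%N)
      l' (nth i0 (enum A) c) * F (nth i0 (enum A) c)).
    rewrite [RHS]big_mkcond; apply: eq_bigr => c _.
    by rewrite mxE; case: ifP => // _; rewrite mul0r.
  rewrite -(big_ord_widen _
    (fun c => l' (nth i0 (enum A) c) * F (nth i0 (enum A) c)) l'k).
  rewrite cardE -(big_mkord predT
    (fun c => l' (nth i0 (enum A) c) * F (nth i0 (enum A) c))).
  rewrite -(big_nth i0 predT (fun i => l' i * F i)) big_enum/=.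
  rewrite [RHS](bigID (mem A))/= [X in _ = _ + X]big1 ?addr0// => i.
  by rewrite inE negbK => /eqP ->; rewrite mul0r.
exists y, m; split; last 2 first.
- by move=> j; rewrite (sumE (u^~ j)).
- by rewrite (sumE v).
split=> [c|]; first by rewrite mxE; case: ifP.
apply: contraTneq lpos => m0; rewrite -l'1.
have mc c : m 0 c = 0 by rewrite m0.
have := sumE (fun=> 1); under [RHS]eq_bigr do rewrite mulr1.
by move=> <-; rewrite big1 ?ltxx// => c _; rewrite mc mul0r.
Qed.

(** * Intervals, generalized inverses and monotone functions *)

Lemma open_contains_smaller (R : realType) (J : set R) (t : R) :
  open J -> J t -> exists2 s, J s & s < t.
Proof.
move=> oJ Jt; have /nbhs_ballP[e /= e0 eJ] := open_nbhs_nbhs (conj oJ Jt).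
exists (t - e / 2); last by rewrite ltrBlDr ltrDl divr_gt0.
by apply: eJ; rewrite /ball/= opprB addrC subrK gtr0_norm; lra.
Qed.

Lemma le_generalized_inverse (R : realType) (J : set R) (f : R -> R) y s :
  is_interval J -> strictly_increasing_on J f -> conv_hull (f @` J) y -> J s ->
  y <= f s -> generalized_inverse J f y <= s.
Proof.
move=> iJ fJ Dy Js ys; have [gmono _ gK] := generalized_inverseP iJ fJ.
rewrite -[leRHS]gK//; apply: gmono; rewrite ?inE//.
by apply: sub_gen_smallest; exists s.
Qed.

Lemma generalized_inverse_lt (R : realType) (J : set R) (f : R -> R) y s :
  is_interval J -> strictly_increasing_on J f -> conv_hull (f @` J) y -> J s ->
  generalized_inverse J f y < s -> y < f s.
Proof.
move=> iJ fJ Dy Js; have [gmono _ gK] := generalized_inverseP iJ fJ.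
rewrite !ltNge; apply: contra => fsy; rewrite -[leLHS]gK//.
apply: gmono; rewrite ?inE//.
by apply: sub_gen_smallest; exists s.
Qed.

(** This converse of [le_generalized_inverse] may fail at a jump of [f], because
    the generalized inverse is constant on the gap that the jump leaves in the
    range of [f]. *)
Lemma generalized_inverse_le_continuity (R : realType) (J : set R)
    (f : R -> R) y s :
  open J -> is_interval J -> strictly_increasing_on J f ->
  conv_hull (f @` J) y -> continuity_points J f s ->
  generalized_inverse J f y <= s -> y <= f s.
Proof.
move=> oJ iJ fJ Dy [Js fs] gys; rewrite leNgt; apply/negP => fsy.
have : \forall z \near s, J z /\ f z < y.
  near=> z; have Jz : J z by near: z; exact: open_nbhs_nbhs.
  split => //; move: Jz; near: z.
  exact: (fs _ (open_nbhs_nbhs (conj (@open_lt _ y) fsy))).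
move=> /nbhs_ballP[e /= e0 eJ].
have se : s < s + e / 2 by rewrite ltrDl divr_gt0.
have [|Jz fz] := eJ (s + e / 2).
  by rewrite /ball/= opprD addNKr normrN gtr0_norm; lra.
have := le_lt_trans gys se.
by move=> /(generalized_inverse_lt iJ fJ Dy Jz); rewrite ltNge ltW.
Unshelve. all: by end_near. Qed.

Lemma sum_weights_gt0 (R : realType) (n : nat) (l : 'rV[R]_n) :
  weights l -> 0 < \sum_i l 0 i.
Proof.
move=> [l0 ln0]; rewrite lt0r sumr_ge0// andbT.
apply: contra_neq ln0 => /psumr_eq0P l1.
by apply/funext => a; apply/funext => i; rewrite ord1; exact: l1.
Qed.

Lemma weighted_sum_le0 (R : realType) (n : nat) (l : 'rV[R]_n) (F : 'I_n -> R)
    (c : R) : weights l ->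
  (\sum_i l 0 i * (F i - c) <= 0) = ((\sum_i l 0 i * F i) / \sum_i l 0 i <= c).
Proof.
move=> wl; rewrite ler_pdivrMr ?sum_weights_gt0// -[RHS]subr_le0 mulr_sumr.
rewrite -sumrB.
by under eq_bigr do rewrite mulrBr (mulrC _ c).
Qed.

Lemma weighted_mean_interval (R : realType) (S : set R) (n : nat)
    (y : 'I_n -> R) (l : 'rV[R]_n) :
  is_interval S -> weights l -> (forall i, S (y i)) ->
  S ((\sum_i l 0 i * y i) / \sum_i l 0 i).
Proof.
move=> iS wl Sy; have lpos := sum_weights_gt0 wl.
have [l0 _] := wl.
have [i1] : exists i : 'I_n, true.
  case: n => [|n] in y l wl Sy lpos l0 *; last by exists ord0.
  by rewrite big_ord0 ltxx in lpos.
move=> i1T.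
case: (@real_arg_minP _ _ i1 predT y i1T (fun i _ => num_real _)) => a _ ya.
case: (@real_arg_maxP _ _ i1 predT y i1T (fun i _ => num_real _)) => b _ yb.
apply: (iS _ _ (Sy a) (Sy b)).
rewrite ler_pdivlMr// ler_pdivrMr// !mulr_sumr.
apply/andP; split; apply: ler_sum => i _; rewrite [_ * l 0 i]mulrC.
  by apply: ler_wpM2l => //; exact: ya.
by apply: ler_wpM2l => //; exact: yb.
Qed.

Lemma conv_hull_is_interval (R : realType) (S : set R) :
  is_interval (conv_hull S).
Proof.
rewrite conv_hullE => u w [a [_ [Sa _ /andP[au _]]]] [_ [b [_ Sb /andP[_ wb]]]].
move=> z /andP[uz zw]; exists a, b; split=> //.
by rewrite (le_trans au)//= (le_trans zw).
Qed.

(** Pass from [x] to [y] by replacing the coordinates one at a time. *)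
Lemma separately_increasing_le (R : realType) (k : nat) (I : 'I_k -> set R)
    (F : 'rV[R]_k -> R) (x y : 'rV[R]_k) :
  separately_increasing_on (box I) F -> box I x -> box I y ->
  (forall j, x 0 j <= y 0 j) -> F x <= F y.
Proof.
move=> incF Ix Iy xy.
pose z n : 'rV[R]_k := \row_j if (j < n)%N then y 0 j else x 0 j.
have Iz n : box I (z n) by move=> j; rewrite mxE; case: ifP.
have -> : y = z k by apply/rowP => j; rewrite mxE ltn_ord.
elim: (X in z X) => [|n IH].
  by rewrite (_ : z 0%N = x)//; apply/rowP => j; rewrite mxE.
apply: le_trans IH _; have [nk|kn] := ltnP n k; last first.
  rewrite (_ : z n.+1 = z n)//; apply/rowP => j.
  by rewrite !mxE (leq_trans (ltn_ord j) kn) (leq_trans (ltn_ord j) (leqW kn)).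
apply: (incF (Ordinal nk)) => // [i ij|].
  have /negPf ni : val i != n := ij.
  by rewrite !mxE ltnS [in RHS]leq_eqVlt ni.
by rewrite !mxE/= ltnn ltnSn.
Qed.

(** The point [m + e], for a small constant [e > 0] added to every coordinate,
    is the centre of a ball of radius [e] that lies in [U] and strictly above
    [m]; density is applied to this ball. *)
Lemma dense_strictly_above (R : realType) (k : nat) (I : 'I_k -> set R)
    (G U : set 'rV[R]_k) (m : 'rV[R]_k) :
  (forall j, open (I j)) -> box I `<=` closure G -> box I m -> nbhs m U ->
  exists t, [/\ G t, U t & forall j, m 0 j < t 0 j].
Proof.
move=> oI dG Im /nbhs_ballP[d /= d0 dU].
have : \forall e \near (0 : R), forall j, I j (m 0 j + e).
  apply: (@filter_forall _ _ (fun j e => I j (m 0 j + e)) (nbhs (0 : R))) => j.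
  have /nbhs_ballP[c /= c0 cI] := open_nbhs_nbhs (conj (oI j) (Im j)).
  apply/nbhs_ballP; exists c => // e; rewrite /ball/= sub0r => ec; apply: cI.
  by rewrite /ball/= opprD addNKr.
move=> /nbhs_ballP[c /= c0 cI].
pose e := Num.min c d / 2.
have [e0 ec ed] : [/\ 0 < e, e < c & e <= d / 2].
  have : 0 < Num.min c d by rewrite lt_min c0 d0.
  have : Num.min c d <= c by rewrite ge_min lexx.
  have : Num.min c d <= d by rewrite ge_min lexx orbT.
  by rewrite /e => ? ? ?; split; lra.
have Ie j : I j (m 0 j + e).
  by apply: cI; rewrite /ball/= sub0r normrN gtr0_norm.
have [|t [Gt [_ pt]]] := dG (\row_j (m 0 j + e)) _ _ (nbhsx_ballx _ e e0).
  by move=> j; rewrite mxE.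
have te j : m 0 j < t 0 j < m 0 j + d.
  have := pt 0 j; rewrite mxE /ball/= ltr_norml => /andP[? ?].
  by apply/andP; split; lra.
exists t; split => // [|j]; last by have /andP[] := te j.
apply: dU; split => // i j; rewrite !ord1; have /andP[? ?] := te j.
by rewrite /ball/= ltr_norml; apply/andP; split; lra.
Qed.

(** * Concave functions on boxes *)

Lemma concave_onP (R : realType) (k : nat) (D : set 'rV[R]_k)
    (F : 'rV[R]_k -> R) :
  concave_on D F <-> forall x y (t : R), D x -> D y -> 0 <= t <= 1 ->
    t * F x + (1 - t) * F y <= F (t *: x + (1 - t) *: y).
Proof.
split=> [cF x y t Dx Dy /andP[t0 t1]|cF t x y /set_mem Dx /set_mem Dy].
  have := cF (Itv01 t0 t1) x y (mem_set Dx) (mem_set Dy).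
  rewrite -[leLHS]/(- F (t *: x + (1 - t) *: y)).
  rewrite -[leRHS]/(t * (- F x) + (1 - t) * (- F y)); lra.
rewrite -[leLHS]/(- F (t%:num *: x + (1 - t%:num) *: y)).
rewrite -[leRHS]/(t%:num * (- F x) + (1 - t%:num) * (- F y)).
have := cF x y t%:num Dx Dy; rewrite ge0 le1 => /(_ isT); lra.
Qed.

Lemma box_convex (R : realType) (k : nat) (I : 'I_k -> set R)
    (x y : 'rV[R]_k) (t : R) :
  (forall j, is_interval (I j)) -> box I x -> box I y -> 0 <= t <= 1 ->
  box I (t *: x + (1 - t) *: y).
Proof.
move=> iI Ix Iy /andP[t0 t1] j; rewrite !mxE.
have [xy|yx] := leP (x 0 j) (y 0 j).
  by apply: (iI j _ _ (Ix j) (Iy j)); apply/andP; split; nra.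
by apply: (iI j _ _ (Iy j) (Ix j)); apply/andP; split; nra.
Qed.

(** Membership of the mean in [D] is proved along with the inequality because
    the induction step evaluates [F] at the mean of the remaining points. *)
Lemma jensen_mean (R : realType) (k n : nat) (D : set 'rV[R]_k)
    (F : 'rV[R]_k -> R) (x : 'I_n.+1 -> 'rV[R]_k) :
  (forall x y (t : R), D x -> D y -> 0 <= t <= 1 ->
     D (t *: x + (1 - t) *: y)) ->
  concave_on D F -> (forall i, D (x i)) ->
  let m := n.+1%:R^-1 *: \sum_i x i in
  D m /\ \sum_i F (x i) <= n.+1%:R * F m.
Proof.
move=> cD /concave_onP cF; elim: n => [|n IH] in x * => Dx /=.
  by rewrite !big_ord1 invr1 scale1r mul1r.
have [Dm Fm] := IH (fun i => x (lift ord0 i)) (fun i => Dx _).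
rewrite [\sum_i x i]big_ord_recl [\sum_i F (x i)]big_ord_recl.
set m := _ *: _ in Dm Fm; set t : R := n.+2%:R^-1.
have n2 : 0 < n.+2%:R :> R by rewrite ltr0n.
have t01 : 0 <= t <= 1.
  by rewrite /t invr_ge0 ler0n/= invf_le1// ler1n.
(* The mean of n + 2 points is the combination, with weights t and
   1 - t = (n + 1) t, of the first point and the mean m of the others. *)
have nt : n.+2%:R * t = 1 by rewrite mulfV ?gt_eqF.
have tn : 1 - t = n.+1%:R * t.
  by have := nt; rewrite -natr1 mulrDl mul1r; lra.
have -> : t *: (x ord0 + \sum_i x (lift ord0 i)) = t *: x ord0 + (1 - t) *: m.
  by rewrite scalerDr tn /m scalerA mulrAC divff ?mul1r ?pnatr_eq0.
split; first exact: cD.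
have := cF _ _ _ (Dx ord0) Dm t01; rewrite -(ler_pM2l n2).
apply: le_trans; rewrite tn mulrDr !mulrA nt mul1r lerD2l.
by rewrite (mulrAC n.+2%:R) nt mul1r.
Qed.

(** * The comparison inequality as a condition on gaps *)

Lemma qamean_wqamean (R : realType) (J : set R) (f : R -> R) (n : nat)
    (x : 'I_n -> R) : qamean J f x = wqamean J f x (const_mx 1).
Proof.
rewrite /qamean /wqamean; congr (generalized_inverse _ _ (_ / _)).
  by apply: eq_bigr => i _; rewrite mxE mul1r.
by under eq_bigr do rewrite mxE; rewrite sumr_const card_ord.
Qed.

Lemma weights_const1 (R : realType) (n : nat) :
  (0 < n)%N -> weights (const_mx 1 : 'rV[R]_n).
Proof.
case: n => // n _; split=> [i|]; first by rewrite mxE.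
apply/eqP => /(congr1 (fun F : 'I_1 -> 'I_n.+1 -> R => F ord0 ord0)).
by rewrite mxE => /eqP; rewrite oner_eq0.
Qed.

Lemma sum_enum_val (R : realType) (J : finType) (F : J -> R) :
  \sum_(c < #|J|) F (enum_val c) = \sum_i F i.
Proof. by rewrite -(big_enum_val F); apply: eq_bigl => i; rewrite inE. Qed.

Lemma wqamean_in (R : realType) (J : set R) (g : R -> R) (n : nat)
    (x : 'I_n -> R) (l : 'rV[R]_n) :
  is_interval J -> strictly_increasing_on J g -> weights l ->
  (forall i, J (x i)) ->
  conv_hull (g @` J) ((\sum_i l 0 i * g (x i)) / \sum_i l 0 i) /\
  J (wqamean J g x l).
Proof.
move=> iJ gJ wl Jx.
have Dm : conv_hull (g @` J) ((\sum_i l 0 i * g (x i)) / \sum_i l 0 i).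
  apply: weighted_mean_interval wl _; first exact: conv_hull_is_interval.
  by move=> i; apply: sub_gen_smallest; exists (x i).
by split=> //; have [_ gD _] := generalized_inverseP iJ gJ; exact: gD.
Qed.

Section MeanComparison.
Variables (R : realType) (k : nat) (I0 : set R) (I : 'I_k -> set R).
Hypotheses (hI0 : open_interval I0) (hI : forall j, open_interval (I j)).
Variables (f0 : R -> R) (f : 'I_k -> R -> R).
Hypotheses (hf0 : strictly_increasing_on I0 f0)
  (hf : forall j, strictly_increasing_on (I j) (f j)).
Variables (phi Phi : 'rV[R]_k -> R).
Hypotheses (hphi : set_fun (box I) I0 phi)
  (hPhi_incr : separately_increasing_on (box I) Phi)
  (hPhi_usc : upper_semicontinuous_on (box I) Phi).
Let Gamma := box I `&` Phi @^-1` continuity_points I0 f0.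
Hypothesis dGamma : box I `<=` closure Gamma.

Let D := box (fun j => conv_hull (f j @` I j)).

Definition gap (t x : 'rV[R]_k) (j : 'I_k) : R := f j (x 0 j) - f j (t 0 j).
Definition gap0 (t x : 'rV[R]_k) : R := f0 (phi x) - f0 (Phi t).

(** The pivot of the proof: an inequality that involves generalized inverses
    and [Phi] at the point of means becomes a family of linear implications.
    The forward direction uses continuity of [f0] at [Phi t]; the backward
    direction lets points [t] of [Gamma] descend to the point of means and uses
    the density of [Gamma] and upper semicontinuity of [Phi]. *)
Lemma mean_inequality_iff_gaps (n : nat) (x : 'I_n -> 'rV[R]_k)
    (l : 'rV[R]_n) : (forall i, box I (x i)) -> weights l ->
  wqamean I0 f0 (fun i => phi (x i)) l
    <= Phi (\row_j wqamean (I j) (f j) (fun i => x i 0 j) l) <->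
  forall t, Gamma t -> (forall j, \sum_i l 0 i * gap t (x i) j <= 0) ->
    \sum_i l 0 i * gap0 t (x i) <= 0.
Proof.
move=> Ix wl; have [_ oI0 iI0] := hI0.
have [D0 m0] := wqamean_in iI0 hf0 wl (fun i => hphi (Ix i)).
have DI j := wqamean_in (let: And3 _ _ iJ := hI j in iJ) (hf (j := j)) wl
  (fun i => Ix i j).
pose m := \row_j wqamean (I j) (f j) (fun i => x i 0 j) l.
have Im : box I m by move=> j; rewrite mxE; case: (DI j).
split=> [mle t Gt gapt|gapl].
  have [It ct] := Gt.
  rewrite weighted_sum_le0//.
  apply: (generalized_inverse_le_continuity oI0) => //.
  apply: le_trans mle _; apply: (separately_increasing_le hPhi_incr) => // j.
  have [_ oI iI] := hI j.
  rewrite mxE; apply: le_generalized_inverse => //; first by case: (DI j).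
  by rewrite -(weighted_sum_le0 (fun i => f j (x i 0 j)) _ wl); exact: gapt.
(* If Phi m were smaller than the mean on the left, then so would be Phi t at
   some t in Gamma strictly above m; but the condition at t bounds that mean
   by Phi t. *)
rewrite leNgt; apply/negP => Phim.
have [t [Gt Ut mt]] := dense_strictly_above
  (fun j => let: And3 _ oJ _ := hI j in oJ) dGamma Im (hPhi_usc Im Phim).
have [It [I0t ct]] := Gt.
suff : wqamean I0 f0 (fun i => phi (x i)) l <= Phi t.
  by rewrite leNgt => /negP; apply; exact: Ut.
apply: le_generalized_inverse => //.
rewrite -(weighted_sum_le0 (fun i => f0 (phi (x i))) _ wl).
apply: gapl => // j; rewrite weighted_sum_le0//.
have [_ oI iI] := hI j.
apply/ltW/(generalized_inverse_lt (J := I j)) => //; first by case: (DI j).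
by have := mt j; rewrite mxE.
Qed.

(** Provides the point with negative gaps that both
    [real_weights_of_unit_weights] and [farkas_nonneg_multipliers] need. *)
Lemma smaller_point (t : 'rV[R]_k) : box I t ->
  exists2 x, box I x & forall j, gap t x j < 0.
Proof.
move=> It.
have /choice[x xP] : forall j, exists s, I j s /\ s < t 0 j.
  move=> j; have [_ oI _] := hI j.
  by have [s] := open_contains_smaller oI (It j); exists s.
exists (\row_j x j) => j; rewrite ?mxE; have [Ix xt] := xP j => //.
by rewrite /gap mxE subr_lt0; apply: hf; rewrite ?inE.
Qed.

(** Indexing by arbitrary finite types rather than by ordinals makes unions of
    families, and families with repetitions, available as sum types and
    dependent pairs. *)
Definition gap_condition (t : 'rV[R]_k) :=
  forall (J : finType) (x : J -> 'rV[R]_k) (l : J -> R),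
  (forall i, box I (x i)) -> (forall i, 0 <= l i) ->
  (forall j, \sum_i l i * gap t (x i) j <= 0) ->
  \sum_i l i * gap0 t (x i) <= 0.

Lemma gap_condition_of_unweighted :
  (forall (n : nat) (x : 'I_n -> 'rV[R]_k), (0 < n)%N ->
    (forall i, box I (x i)) ->
    qamean I0 f0 (fun i => phi (x i))
      <= Phi (\row_j qamean (I j) (f j) (fun i => x i 0 j))) ->
  forall t, Gamma t -> gap_condition t.
Proof.
move=> H t Gt; have [It _] := Gt; have [x0 Ix0 gx0] := smaller_point It.
apply: (real_weights_of_unit_weights Ix0 gx0) => J x Ix gx.
have [J0|J0] := posnP #|J|.
  by rewrite big1// => i _; have := fintype0 i J0.
have := H _ (fun c => x (enum_val c)) J0 (fun c => Ix _).
rewrite qamean_wqamean.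
under eq_mx do rewrite qamean_wqamean.
move/(mean_inequality_iff_gaps _ (weights_const1 _ J0)).
move=> /(_ (fun c => Ix _) t Gt).
have unitE (F : 'I_#|J| -> R) : 
      \sum_c (const_mx 1 : 'rV[R]_#|J|) 0 c * F c = \sum_c F c.
  by apply: eq_bigr => c _; rewrite mxE mul1r.
move=> gle; rewrite -sum_enum_val -unitE; apply: gle => j.
by rewrite unitE (sum_enum_val (fun i => gap t (x i) j)).
Qed.

Lemma gap_condition_of_k1_weights :
  (forall (x : 'I_k.+1 -> 'rV[R]_k) (l : 'rV[R]_k.+1),
    (forall i, box I (x i)) -> weights l ->
    wqamean I0 f0 (fun i => phi (x i)) l
      <= Phi (\row_j wqamean (I j) (f j) (fun i => x i 0 j) l)) ->
  forall t, Gamma t -> gap_condition t.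
Proof.
move=> H t Gt J x l Ix l0 gx.
have : 0 <= \sum_i l i by exact: sumr_ge0.
rewrite le_eqVlt => /predU1P[/esym/psumr_eq0P l1|lpos].
  by rewrite big1// => i _; rewrite l1 ?mul0r.
have [y [m [wm my mv]]] := caratheodory_points (fun i => gap t (x i))
  (fun i => gap0 t (x i)) l0 lpos.
apply: le_trans mv _.
have /(mean_inequality_iff_gaps (fun c => Ix (y c)) wm) :=
  H (fun c => x (y c)) m (fun c => Ix (y c)) wm.
by apply=> // j; rewrite my.
Qed.

Lemma weighted_of_gap_condition : (forall t, Gamma t -> gap_condition t) ->
  forall (n : nat) (x : 'I_n -> 'rV[R]_k) (l : 'rV[R]_n), (0 < n)%N ->
    (forall i, box I (x i)) -> weights l ->
    wqamean I0 f0 (fun i => phi (x i)) l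
      <= Phi (\row_j wqamean (I j) (f j) (fun i => x i 0 j) l).
Proof.
move=> H n x l _ Ix wl; apply/mean_inequality_iff_gaps => // t Gt.
by apply: (H t Gt _ x (fun i => l 0 i)) => //; case: wl.
Qed.

Lemma multipliers_of_gap_condition : (forall t, Gamma t -> gap_condition t) ->
  exists a : 'I_k -> 'rV[R]_k -> R,
    (forall j t, Gamma t -> 0 <= a j t) /\
    (forall x t, box I x -> Gamma t ->
      f0 (phi x) - f0 (Phi t)
        <= \sum_(j < k) a j t * (f j (x 0 j) - f j (t 0 j))).
Proof.
move=> H.
have /choice[a aP] : forall t, exists a : 'I_k -> R, Gamma t ->
    (forall j, 0 <= a j) /\
    forall x, box I x -> gap0 t x <= \sum_j a j * gap t x j.
  move=> t; have [Gt|nGt] := pselect (Gamma t); last by exists (fun=> 0).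
  have [It _] := Gt; have [x0 Ix0 gx0] := smaller_point It.
  by have [a aP] := farkas_nonneg_multipliers Ix0 gx0 (H t Gt); exists a.
exists (fun j t => a t j); split=> [j t /aP[]//|x t Ix /aP[_]].
exact.
Qed.

(** * Multipliers and concave majorants *)

(** [Psi] is the lower envelope of the affine functions with slopes [a _ t]
    supporting at [t].  It is finite on [D]: any [y] there dominates some
    [f x], where (d) bounds all the affine functions from below by
    [f0 (phi x)], and the slopes are nonnegative. *)
Lemma majorant_of_multipliers :
  (exists a : 'I_k -> 'rV[R]_k -> R,
    (forall j t, Gamma t -> 0 <= a j t) /\
    (forall x t, box I x -> Gamma t ->
      f0 (phi x) - f0 (Phi t)
        <= \sum_(j < k) a j t * (f j (x 0 j) - f j (t 0 j)))) ->
  exists Psi : 'rV[R]_k -> R,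
    [/\ separately_increasing_on D Psi, concave_on D Psi,
        (forall x, box I x -> f0 (phi x) <= Psi (\row_j f j (x 0 j))) &
        (forall t, Gamma t -> Psi (\row_j f j (t 0 j)) <= f0 (Phi t))].
Proof.
move=> [a [a0 aP]].
pose A t (y : 'rV[R]_k) := f0 (Phi t) + \sum_j a j t * (y 0 j - f j (t 0 j)).
pose Psi y := inf [set A t y | t in Gamma].
have AE t (x : 'rV[R]_k) : A t (\row_j f j (x 0 j)) =
    f0 (Phi t) + \sum_j a j t * (f j (x 0 j) - f j (t 0 j)).
  by rewrite /A; under eq_bigr do rewrite mxE.
have leA t (y z : 'rV[R]_k) :
    Gamma t -> (forall j, y 0 j <= z 0 j) -> A t y <= A t z.
  move=> Gt yz; rewrite lerD2l; apply: ler_sum => j _.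
  by rewrite ler_wpM2l ?a0// lerD2r.
have [t0 Gt0] : Gamma !=set0.
  have /choice[x Ix] : forall j, exists s, I j s.
    by move=> j; have [[s Is] _ _] := hI j; exists s.
  have Ix' : box I (\row_j x j) by move=> j; rewrite mxE.
  have [t [Gt _]] := dGamma Ix' filterT.
  by exists t.
have A_ne y : [set A t y | t in Gamma] !=set0 by exists (A t0 y), t0.
have A_lb y : D y -> has_lbound [set A t y | t in Gamma].
  move=> Dy; have /choice[x xP] : forall j, exists s, I j s /\ f j s <= y 0 j.
    move=> j; have := Dy j; rewrite conv_hullE.
    by move=> [_ [_ [[s Is <-] _ /andP[sy _]]]]; exists s.
  exists (f0 (phi (\row_j x j))) => _ [t Gt <-].
  have Ix : box I (\row_j x j) by move=> j; rewrite mxE; case: (xP j).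
  apply: (@le_trans _ _ (A t (\row_j f j ((\row_j x j) 0 j)))).
    by rewrite AE -lerBlDl; exact: aP.
  by apply: leA => // j; rewrite !mxE; case: (xP j).
exists Psi; split.
- move=> j y z Dy Dz yz yzj; apply: lb_le_inf => // _ [t Gt <-].
  apply: (@le_trans _ _ (A t y)).
    by apply: ge_inf; [exact: A_lb|exists t].
  apply: leA => // i; have [->//|ij] := eqVneq i j.
  by rewrite yz.
- apply/concave_onP => y z s Dy Dz /andP[s0 s1].
  apply: lb_le_inf => // _ [t Gt <-].
  have -> : A t (s *: y + (1 - s) *: z) = s * A t y + (1 - s) * A t z.
    rewrite /A !mulrDr addrACA !mulr_sumr -big_split/= -mulrDl subrKC mul1r.
    by congr (_ + _); apply: eq_bigr => j _; rewrite !mxE; ring.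
  by apply: lerD; rewrite ler_wpM2l ?subr_ge0//; apply: ge_inf;
    [exact: A_lb|exists t|exact: A_lb|exists t].
- move=> x Ix; apply: lb_le_inf => // _ [t Gt <-].
  by rewrite AE -lerBlDl; exact: aP.
- move=> t Gt; have [It _] := Gt.
  apply: (@le_trans _ _ (A t (\row_j f j (t 0 j)))).
    apply: ge_inf; last by exists t.
    apply: A_lb => j; rewrite mxE; apply: sub_gen_smallest.
    by exists (t 0 j).
  by rewrite AE big1 ?addr0// => j _; rewrite subrr mulr0.
Qed.

(** By [mean_inequality_iff_gaps] it suffices to compare the sums at a point
    [t] of [Gamma].  There the sum of the [f0 (phi (x i))] is at most the sum of
    the values of [Psi], hence by Jensen at most [n] times [Psi] at the mean,
    and the premise on the gaps places this mean below [f t]. *)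
Lemma unweighted_of_majorant :
  (exists Psi : 'rV[R]_k -> R,
    [/\ separately_increasing_on D Psi, concave_on D Psi,
        (forall x, box I x -> f0 (phi x) <= Psi (\row_j f j (x 0 j))) &
        (forall t, Gamma t -> Psi (\row_j f j (t 0 j)) <= f0 (Phi t))]) ->
  forall (n : nat) (x : 'I_n -> 'rV[R]_k), (0 < n)%N ->
    (forall i, box I (x i)) ->
    qamean I0 f0 (fun i => phi (x i))
      <= Phi (\row_j qamean (I j) (f j) (fun i => x i 0 j)).
Proof.
move=> [Psi [Psi_incr Psi_conc phi_Psi Psi_Phi]] [//|n] x _ Ix.
rewrite qamean_wqamean.
have -> : (\row_j qamean (I j) (f j) (fun i => x i 0 j)) =
    \row_j wqamean (I j) (f j) (fun i => x i 0 j) (const_mx 1).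
  by apply/rowP => j; rewrite !mxE qamean_wqamean.
apply/mean_inequality_iff_gaps => //; first exact: weights_const1.
move=> t Gt; have [It _] := Gt.
have unitE (F : 'I_n.+1 -> R) :
    \sum_c (const_mx 1 : 'rV[R]_n.+1) 0 c * F c = \sum_c F c.
  by apply: eq_bigr => c _; rewrite mxE mul1r.
have Df y : box I y -> D (\row_j f j (y 0 j)).
  by move=> Iy j; rewrite mxE; apply: sub_gen_smallest; exists (y 0 j).
have cD (y z : 'rV[R]_k) (s : R) : D y -> D z -> 0 <= s <= 1 ->
    D (s *: y + (1 - s) *: z).
  by apply: box_convex => j; exact: conv_hull_is_interval.
have [Dm Psi_m] := jensen_mean cD Psi_conc (fun i => Df _ (Ix i)).
rewrite unitE => gapt; rewrite sumrB sumr_const card_ord subr_le0 -mulr_natl.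
apply: (@le_trans _ _ (\sum_i Psi (\row_j f j (x i 0 j)))).
  by apply: ler_sum => i _; exact: phi_Psi.
apply: le_trans Psi_m _; rewrite ler_pM2l ?ltr0n//.
apply: le_trans (Psi_Phi _ Gt).
apply: (separately_increasing_le Psi_incr) => //; first exact: Df.
move=> j; rewrite !mxE summxE mulrC ler_pdivrMr ?ltr0n// -subr_le0.
have := gapt j; rewrite unitE sumrB sumr_const card_ord mulr_natr.
by under [X in _ -> X - _ <= _]eq_bigr do rewrite mxE.
Qed.

End MeanComparison.

Theorem theorem3p1 (R : realType) (k : nat) (hk : (0 < k)%N)
    (I0 : set R) (I : 'I_k -> set R)
    (hI0 : open_interval I0) (hI : forall j, open_interval (I j))
    (f0 : R -> R) (f : 'I_k -> R -> R)
    (hf0 : strictly_increasing_on I0 f0)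
    (hf : forall j, strictly_increasing_on (I j) (f j))
    (phi Phi : 'rV[R]_k -> R)
    (hphi : set_fun (box I) I0 phi)
    (hPhi_incr : separately_increasing_on (box I) Phi)
    (hPhi_usc : upper_semicontinuous_on (box I) Phi) :
  let Gamma := box I `&` Phi @^-1` continuity_points I0 f0 in
  box I `<=` closure Gamma ->
  [<->
    (* (a) *)
    forall (n : nat) (x : 'I_n -> 'rV[R]_k), (0 < n)%N ->
      (forall i, box I (x i)) ->
      qamean I0 f0 (fun i => phi (x i))
        <= Phi (\row_j qamean (I j) (f j) (fun i => x i 0 j));
    (* (b) *)
    forall (n : nat) (x : 'I_n -> 'rV[R]_k) (l : 'rV[R]_n), (0 < n)%N ->
      (forall i, box I (x i)) -> weights l ->
      wqamean I0 f0 (fun i => phi (x i)) l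
        <= Phi (\row_j wqamean (I j) (f j) (fun i => x i 0 j) l);
    (* (c) *)
    forall (x : 'I_k.+1 -> 'rV[R]_k) (l : 'rV[R]_k.+1),
      (forall i, box I (x i)) -> weights l ->
      wqamean I0 f0 (fun i => phi (x i)) l
        <= Phi (\row_j wqamean (I j) (f j) (fun i => x i 0 j) l);
    (* (d) *)
    exists a : 'I_k -> 'rV[R]_k -> R,
      (forall j t, Gamma t -> 0 <= a j t) /\
      (forall x t, box I x -> Gamma t ->
        f0 (phi x) - f0 (Phi t)
          <= \sum_(j < k) a j t * (f j (x 0 j) - f j (t 0 j)));
    (* (e) *)
    exists Psi : 'rV[R]_k -> R,
      let D := box (fun j => conv_hull (f j @` I j)) in
      [/\ separately_increasing_on D Psi, concave_on D Psi,
          (forall x, box I x -> f0 (phi x) <= Psi (\row_j f j (x 0 j))) &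
          (forall t, Gamma t -> Psi (\row_j f j (t 0 j)) <= f0 (Phi t))]
  ].

Proof.
move=> Gamma dGamma; tfae.
- move=> Ha.
  apply: (weighted_of_gap_condition hI0 hI hf0 hf hphi hPhi_incr hPhi_usc
    dGamma).
  exact: (gap_condition_of_unweighted hI0 hI hf0 hf hphi hPhi_incr hPhi_usc
    dGamma Ha).
- by move=> Hb x l Ix; exact: Hb.
- move=> Hc; apply: (multipliers_of_gap_condition hI hf).
  exact: (gap_condition_of_k1_weights hI0 hI hf0 hf hphi hPhi_incr hPhi_usc
    dGamma Hc).
- exact: (majorant_of_multipliers hI dGamma).
- exact: (unweighted_of_majorant hI0 hI hf0 hf hphi hPhi_incr hPhi_usc dGamma).
Qed.
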